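(* Let $g=(g_1,\ldots,g_r)$ and $h=(h_1,\ldots,h_s)$ with $g_i,h_j\in\mathbb{R}[x_1,\ldots,x_n]$, let $S=\{x\in\mathbb{R}^n:g(x)=0,\ h(x)\le0\}$, let $\bar x\in S$, and let $u\in T_S(\bar x)$. Suppose that the gradients $$\nabla g_i(\bar x),\ i=1,\ldots,r,\qquad \nabla h_j(\bar x),\ j\in I_0(\bar x;u),$$ are linearly independent and that the family of gradients $\nabla g_i(x)$, $i=1,\ldots,r$, $\nabla h_j(x)$, $j\in I_0(\bar x;u)$, remains of constant rank on the active stratum selected by $u$, i.e. at all points $x$ near $\bar x$ with $g(x)=0$ and $h_j(x)=0$ for $j\in I_0(\bar x;u)$. Then $$T^2_S(\bar x;u)=\mathcal{L}^2_S(\bar x;u).$$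
   Context: Bouligand tangent cone: $T_S(\bar x)=\{u\in\mathbb{R}^n:\exists t_k\downarrow 0,\ \exists u_k\to u \text{ with } \bar x+t_ku_k\in S\text{ for all }k\}$ ($t_k\downarrow0$ means $t_k>0$, $t_k\to0$). $T^2_S(\bar x;u)$ is the (outer) parabolic second-order tangent set: all $w\in\mathbb{R}^n$ such that there exist $t_k\downarrow0$ and $w_k\to w$ with $\bar x+t_ku+\tfrac12t_k^2w_k\in S$ for all $k$. Active indices: $I(\bar x)=\{j\in\{1,\ldots,s\}:h_j(\bar x)=0\}$, $I_0(\bar x;u)=\{j\in I(\bar x):\nabla h_j(\bar x)u=0\}$. $\mathcal{L}^2_S(\bar x;u)$ is the set of $w\in\mathbb{R}^n$ with $Dg(\bar x)w+D^2g(\bar x)[u,u]=0$ and $\nabla h_j(\bar x)w+u^T\nabla^2h_j(\bar x)u\le0$ for all $j\in I_0(\bar x;u)$, where $D^2g(\bar x)[u,u]=(u^T\nabla^2g_i(\bar x)u)_{i=1}^r$. *)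

(* Defs.v *)
From HB Require Import structures.
From mathcomp Require Import all_boot all_order all_algebra.
From mathcomp Require Import boolp classical_sets reals topology normedtype
  sequences.
(* The notations of mpoly do not parse together with those of
   MathComp-Analysis, so {mpoly R[n]} is written mpoly n R, p.@[v] is
   meval v p and p^`M(i) is mderiv i p. *)
From mathcomp Require Import -(notations) mpoly.

Set Implicit Arguments.
Unset Strict Implicit.
Unset Printing Implicit Defensive.

Import Order.TTheory GRing.Theory Num.Theory.
Import numFieldNormedType.Exports.

Local Open Scope classical_set_scope.
Local Open Scope ring_scope.

(* Points and directions of R^n are column vectors; gradients are row vectors,
   so that a directional derivative is the 1 x 1 matrix grad p x *m w. *)

Section Polynomials.
Variables (R : realType) (n : nat).
Implicit Types (p : mpoly n R) (x u w : 'cV[R]_n).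

Definition peval p x : R := meval (fun i => x i 0) p.

Definition grad p x : 'rV[R]_n := \row_i peval (mderiv i p) x.

Definition hess p x : 'M[R]_n :=
  \matrix_(i, j) peval (mderiv j (mderiv i p)) x.

Definition dirder p x w : R := (grad p x *m w) 0 0.

Definition hessq p x u : R := (u^T *m hess p x *m u) 0 0.

Definition jac m (f : 'I_m -> mpoly n R) x : 'M[R]_(m, n) :=
  \matrix_(i < m) grad (f i) x.

Definition D2 m (f : 'I_m -> mpoly n R) x u : 'cV[R]_m :=
  \col_i hessq (f i) x u.

End Polynomials.

Section TangentSets.
Variables (R : realType) (n : nat).
Implicit Types (S : set 'cV[R]_n) (x u w : 'cV[R]_n).

Definition decr0 (t : nat -> R) : Prop :=
  (forall k, 0 < t k) /\ (t k @[k --> \oo] --> (0 : R)).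

Definition tangent_cone S x : set 'cV[R]_n :=
  [set u | exists (t : nat -> R) (v : nat -> 'cV[R]_n),
     [/\ decr0 t, v k @[k --> \oo] --> u & forall k, S (x + t k *: v k)]].

Definition tangent2_set S x u : set 'cV[R]_n :=
  [set w | exists (t : nat -> R) (v : nat -> 'cV[R]_n),
     [/\ decr0 t, v k @[k --> \oo] --> w
       & forall k, S (x + t k *: u + (2^-1 * t k ^+ 2) *: v k)]].

End TangentSets.

Section ConstraintSystem.
Variables (R : realType) (n r s : nat).
Variables (g : 'I_r -> mpoly n R) (h : 'I_s -> mpoly n R).
Implicit Types (x u w : 'cV[R]_n).

Definition feasible : set 'cV[R]_n :=
  [set x | (forall i, peval (g i) x = 0) /\ (forall j, peval (h j) x <= 0)].

Definition active x : {set 'I_s} := [set j | peval (h j) x == 0]%SET.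

Definition active0 x u : {set 'I_s} :=
  [set j in active x | dirder (h j) x u == 0]%SET.

(* For J a set of indices of inequality constraints: the matrix whose rows
   are the gradients at x of all the g i and of the h j, j \in J (each index
   giving exactly one row, so that row_free is independence of the family). *)
Definition grad_family (J : {set 'I_s}) x : 'M[R]_(r + #|J|, n) :=
  col_mx (jac g x) (jac (fun k : 'I_#|J| => h (enum_val k)) x).

Definition stratum (J : {set 'I_s}) : set 'cV[R]_n :=
  [set x | (forall i, peval (g i) x = 0)
        /\ (forall j, j \in J -> peval (h j) x = 0)].

Definition linearized2_set x u : set 'cV[R]_n :=
  [set w | jac g x *m w + D2 g x u = 0
        /\ (forall j, j \in active0 x u ->
              dirder (h j) x w + hessq (h j) x u <= 0)].

End ConstraintSystem.

(* Main.v *)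
Require Import Defs.
From HB Require Import structures.
From mathcomp Require Import all_boot all_order all_algebra.
From mathcomp Require Import ring lra.
From mathcomp Require Import boolp classical_sets functions reals
  interval_inference topology normedtype sequences realfun.
From mathcomp Require Import -(notations) mpoly.

(** Along a parabola x + t u + (t^2/2) v a polynomial p satisfies the identity
      p = p(x) + t Dp(x)u + (t^2/2) (Dp(x)v + D2p(x)[u,u]) + t^3 f(t,v)
    in which f is again a polynomial in (t, v), hence bounded and Lipschitz
    in v uniformly for bounded (t, v) ([has_taylor_poly]).  Both inclusions are
    read off this identity.

    A second-order tangent vector w satisfies the linearized system: if p is
    nonpositive on S and vanishes to first order at x along u, dividing
    p(x + t_k u + (t_k^2/2) w_k) <= 0 by t_k^2/2 and passing to the limit gives
    Dp(x)w + D2p(x)[u,u] <= 0 ([tangent2_le]).  The first-order relations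
    satisfied by a tangent direction u are the same statement with base
    direction 0, since x + t v = x + 0 + (T^2/2) v for T = sqrt (2t)
    ([tangent_cone_sub]).

    Conversely let w satisfy the linearized system, let F collect the g_i and
    the h_j with j in I_0, and let B be a right inverse of the Jacobian A of F
    at x, which exists by linear independence.  Trying v = w + B z, the Taylor
    identity reads F = (t^2/2) (A w + D2F[u,u] + z + 2 t f(t, w + B z)); for
    small t the map z |-> - 2 t f(t, w + B z) contracts the closed unit ball, and
    its fixed point z is O(t).  The resulting points satisfy
    F = (t^2/2) (A w + D2F[u,u]) exactly, so g = 0 and h_j <= 0 for j in I_0
    ([second_order_arc]).  Every other inequality is strict at x, or active with
    strictly negative derivative along u, and so holds for all small t
    ([parabola_le0]). *)

Set Implicit Arguments.
Unset Strict Implicit.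
Unset Printing Implicit Defensive.

Import Order.TTheory GRing.Theory Num.Theory.
Import numFieldNormedType.Exports.

Local Open Scope classical_set_scope.
Local Open Scope ring_scope.

(** * Directional derivatives of polynomials *)

Section DirectionalDerivatives.
Variables (R : realType) (n : nat).
Implicit Types (p q : mpoly n R) (x u v w : 'cV[R]_n).

(** The derivative along u is kept as a polynomial: it is a derivation that can
    be iterated, which spares product rules for gradients and Hessians. *)
Definition dder u p : mpoly n R := \sum_i u i 0 *: mderiv i p.

Lemma dderD u p q : dder u (p + q) = dder u p + dder u q.
Proof.
by rewrite -big_split; apply: eq_bigr => i _; rewrite mderivD scalerDr.
Qed.

Lemma dderZ u c p : dder u (c *: p) = c *: dder u p.
Proof.
rewrite scaler_sumr; apply: eq_bigr => i _.
by rewrite mderivZ !scalerA mulrC.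
Qed.

Lemma dderM u p q : dder u (p * q) = dder u p * q + p * dder u q.
Proof.
rewrite mulr_suml mulr_sumr -big_split; apply: eq_bigr => i _ /=.
by rewrite mderivM scalerDr scalerAl scalerAr.
Qed.

Lemma dderC u c : dder u (mpolyC n c) = 0.
Proof. by apply: big1 => i _; rewrite mderivC scaler0. Qed.

Lemma dderX u i : dder u (mpolyX R (mnm1 i)) = mpolyC n (u i 0).
Proof.
rewrite /dder (bigD1 i) //= big1 => [|j ji].
  rewrite mderivX mnm1E eqxx.
  have -> : mnm_sub (mnm1 i) (mnm1 i) = mnm0 :> multinom n.
    by apply/mnmP => k; rewrite mnmBE subnn mnm0E.
  by rewrite mpolyX0 scale1r addr0 alg_mpolyC.
by rewrite mderivX mnm1E eq_sym (negPf ji) scale0r scaler0.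
Qed.

Lemma pevalD p q x : peval (p + q) x = peval p x + peval q x.
Proof. exact: mevalD. Qed.

Lemma pevalN p x : peval (- p) x = - peval p x.
Proof. exact: mevalN. Qed.

Lemma pevalM p q x : peval (p * q) x = peval p x * peval q x.
Proof. exact: mevalM. Qed.

Lemma pevalZ c p x : peval (c *: p) x = c * peval p x.
Proof. exact: mevalZ. Qed.

Lemma dirderE p x u : dirder p x u = peval (dder u p) x.
Proof.
rewrite /dirder mxE /peval raddf_sum; apply: eq_bigr => i _ /=.
by rewrite mxE mevalZ mulrC.
Qed.

Lemma hessqE p x u : hessq p x u = peval (dder u (dder u p)) x.
Proof.
rewrite /hessq mxE /peval /dder raddf_sum; apply: eq_bigr => i _ /=.
rewrite mevalZ mulrC mxE; congr (_ * _).
rewrite (raddf_sum (mderiv i)) raddf_sum; apply: eq_bigr => j _ /=.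
by rewrite mderivZ mevalZ !mxE.
Qed.

Lemma dirderN p x u : dirder (- p) x u = - dirder p x u.
Proof. by rewrite !dirderE -scaleN1r dderZ pevalZ mulN1r. Qed.

Lemma hessqN p x u : hessq (- p) x u = - hessq p x u.
Proof. by rewrite !hessqE -scaleN1r !dderZ pevalZ mulN1r. Qed.

End DirectionalDerivatives.

Lemma jac_mulmxE (R : realType) n m (F : 'I_m -> mpoly n R) x w i :
  (jac F x *m w) i 0 = dirder (F i) x w.
Proof. by rewrite /dirder !mxE; apply: eq_bigr => j _; rewrite !mxE. Qed.

(** * The sup norm on column vectors *)

Section MatrixNorm.
Variable R : realType.

(* Matrices carry their norm and their completeness separately; this declares
   the join, over which the Banach fixed point theorem is stated. *)
HB.instance Definition _ m n := Complete.on 'M[R]_(m, n).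

Lemma ler_cV_norm m (z : 'cV[R]_m) c :
  0 <= c -> (forall i, `|z i 0| <= c) -> `|z| <= c.
Proof.
move=> c0 zc; rewrite [leLHS]/Num.norm /= mx_normrE; apply: bigmax_le => // -[i j] _.
by rewrite ord1.
Qed.

Lemma ler_norm_coord m (z : 'cV[R]_m) i : `|z i 0| <= `|z|.
Proof.
rewrite [leRHS]/Num.norm /= mx_normrE.
exact: (le_bigmax _ (fun ij : 'I_m * 'I_1 => `|z ij.1 ij.2|) (i, 0)).
Qed.

Lemma mulmx_bounded m n (B : 'M[R]_(m, n)) :
  exists2 K, 0 <= K & forall z : 'cV_n, `|B *m z| <= K * `|z|.
Proof.
exists (\sum_i \sum_j `|B i j|).
  by apply: sumr_ge0 => i _; apply: sumr_ge0.
move=> z; have S0 i : 0 <= \sum_j `|B i j| by apply: sumr_ge0.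
apply: ler_cV_norm => [|i]; first by rewrite mulr_ge0 // sumr_ge0.
apply: (@le_trans _ _ ((\sum_j `|B i j|) * `|z|)).
  rewrite mxE mulr_suml (le_trans (ler_norm_sum _ _ _)) // ler_sum // => j _.
  by rewrite normrM ler_wpM2l // ler_norm_coord.
rewrite ler_wpM2r // (bigD1 i) //= lerDl.
by apply: sumr_ge0.
Qed.

Lemma dirder_bounded n (p : mpoly n R) x :
  exists2 K, 0 <= K & forall v, `|dirder p x v| <= K * `|v|.
Proof.
have [K K0 HK] := mulmx_bounded (grad p x).
by exists K => // v; apply: le_trans (HK v); apply: ler_norm_coord.
Qed.

Lemma dirderB n (p : mpoly n R) x v w :
  dirder p x (v - w) = dirder p x v - dirder p x w.
Proof. by rewrite /dirder mulmxBr !mxE. Qed.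

End MatrixNorm.

(** * Second-order Taylor expansion along a parabola *)

Section Tame.
Variables (R : realType) (n : nat).
Implicit Types (f : R -> 'cV[R]_n -> R) (p q : mpoly n R) (x u v w : 'cV[R]_n).

(** What is retained of a remainder that is polynomial in (t, v): bounds uniform
    in the time t.  Boundedness makes t f(t, v) negligible, and the Lipschitz bound
    makes t f(t, .) a contraction for small t. *)
Definition tame f := forall M, exists2 L, 0 <= L &
  forall t v v', `|t| <= 1 -> `|v| <= M -> `|v'| <= M ->
    `|f t v| <= L /\ `|f t v - f t v'| <= L * `|v - v'|.

Lemma tame_cst c : tame (fun _ _ => c).
Proof.
by move=> M; exists `|c| => // t v v' _ _ _; rewrite subrr normr0 mulr_ge0.
Qed.

Lemma tame_time : tame (fun t _ => t).
Proof.
by move=> M; exists 1 => // t v v' t1 _ _; rewrite subrr normr0 mulr_ge0.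
Qed.

Lemma tame_dirder p x : tame (fun _ v => dirder p x v).
Proof.
move=> M; have [K K0 HK] := dirder_bounded p x.
(* The absolute value keeps the constant nonnegative when M is negative. *)
exists (K * `|M| + K) => [|t v v' _ vM _]; first by rewrite addr_ge0 ?mulr_ge0.
have M0 := le_trans (normr_ge0 v) vM; split.
  rewrite (le_trans (HK v)) // (@le_trans _ _ (K * `|M|)) ?lerDl //.
  by rewrite ler_wpM2l // ger0_norm.
by rewrite -dirderB (le_trans (HK _)) // ler_wpM2r // lerDr mulr_ge0.
Qed.

Lemma tameD f1 f2 : tame f1 -> tame f2 -> tame (fun t v => f1 t v + f2 t v).
Proof.
move=> tf1 tf2 M; have [L1 L10 H1] := tf1 M; have [L2 L20 H2] := tf2 M.
exists (L1 + L2) => [|t v v' t1 vM v'M]; first exact: addr_ge0.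
have [b1 d1] := H1 t v v' t1 vM v'M; have [b2 d2] := H2 t v v' t1 vM v'M.
split; first by rewrite (le_trans (ler_normD _ _)) // lerD.
by rewrite opprD addrACA (le_trans (ler_normD _ _)) // mulrDl lerD.
Qed.

Lemma tameM f1 f2 : tame f1 -> tame f2 -> tame (fun t v => f1 t v * f2 t v).
Proof.
move=> tf1 tf2 M; have [L1 L10 H1] := tf1 M; have [L2 L20 H2] := tf2 M.
have L12 : 0 <= L1 * L2 by rewrite mulr_ge0.
exists (L1 * L2 + L1 * L2) => [|t v v' t1 vM v'M]; first exact: addr_ge0.
have [b1 d1] := H1 t v v' t1 vM v'M; have [b2 d2] := H2 t v v' t1 vM v'M.
have [b2' _] := H2 t v' v t1 v'M vM; split.
  by rewrite normrM (le_trans (ler_pM _ _ b1 b2)) // lerDl.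
have -> : f1 t v * f2 t v - f1 t v' * f2 t v' =
  f1 t v * (f2 t v - f2 t v') + (f1 t v - f1 t v') * f2 t v' by ring.
rewrite (le_trans (ler_normD _ _)) // !normrM mulrDl lerD //.
  by rewrite -mulrA ler_pM.
by rewrite mulrAC ler_pM.
Qed.

Definition parabola x u v t : 'cV[R]_n := x + t *: u + (2^-1 * t ^+ 2) *: v.

Definition taylor_with x u p f := forall t v,
  peval p (parabola x u v t) = peval p x + t * dirder p x u
    + 2^-1 * t ^+ 2 * (dirder p x v + hessq p x u) + t ^+ 3 * f t v.

Definition has_taylor x u p := exists2 f, tame f & taylor_with x u p f.

Lemma has_taylorC x u c : has_taylor x u (mpolyC n c).
Proof.
exists (fun _ _ => 0); first exact: tame_cst.
move=> t v; rewrite hessqE !dirderE !dderC.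
by rewrite /peval !mevalC ?meval0; ring.
Qed.

Lemma has_taylorX x u i : has_taylor x u (mpolyX R (mnm1 i)).
Proof.
exists (fun _ _ => 0); first exact: tame_cst.
move=> t v; rewrite hessqE !dirderE !dderX dderC.
by rewrite /peval !mevalC !mevalXU ?meval0 !mxE; ring.
Qed.

Lemma has_taylorD x u p q :
  has_taylor x u p -> has_taylor x u q -> has_taylor x u (p + q).
Proof.
move=> [f tf pf] [f' tf' qf']; exists (fun t v => f t v + f' t v).
  exact: tameD.
move=> t v; rewrite pevalD pf qf' !hessqE !dirderE !dderD !pevalD; ring.
Qed.

(** The remainder of a product collects the terms of order at least 3 in the
    product of the two expansions; it is a sum of products of tame functions. *)
Lemma has_taylorM x u p q :
  has_taylor x u p -> has_taylor x u q -> has_taylor x u (p * q).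
Proof.
move=> [f tf pf] [f' tf' qf'].
pose c (t : R) v := dirder p x v + hessq p x u.
pose c' (t : R) v := dirder q x v + hessq q x u.
have tc : tame c by apply: tameD; [exact: tame_dirder | exact: tame_cst].
have tc' : tame c' by apply: tameD; [exact: tame_dirder | exact: tame_cst].
exists (fun (t : R) v =>
  2^-1 * (dirder p x u * c' t v + dirder q x u * c t v)
  + (peval p x * f' t v + peval q x * f t v)
  + t * (4^-1 * (c t v * c' t v) + (dirder p x u * f' t v + dirder q x u * f t v))
  + t * t * (2^-1 * (c t v * f' t v + c' t v * f t v))
  + t * (t * t) * (f t v * f' t v)).
  by do ?[exact: tf | exact: tf' | exact: tc | exact: tc' | exact: tame_cst
    | exact: tame_time | apply: tameD | apply: tameM].
move=> t v; rewrite pevalM pf qf' /c /c' !hessqE !dirderE !dderM !dderD !dderM.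
by rewrite !pevalD !pevalM; field.
Qed.

(** Constants and variables have an expansion with zero remainder, and they
    generate all polynomials under sums and products. *)
Lemma has_taylor_poly x u p : has_taylor x u p.
Proof.
elim/mpolyind: p => [|c m p _ _ IHp].
  by have := has_taylorC x u 0; rewrite mpolyC0.
apply: has_taylorD => //; rewrite -mul_mpolyC.
apply: has_taylorM; first exact: has_taylorC.
have T1 : has_taylor x u 1 by have := has_taylorC x u 1; rewrite mpolyC1.
rewrite mpolyXE_id; apply: (big_ind (has_taylor x u)) => // [p1 p2|i _].
  exact: has_taylorM.
elim: (m i) => [|k IHk]; first by rewrite expr0.
by rewrite exprS; apply: has_taylorM => //; exact: has_taylorX.
Qed.

End Tame.

(** * Necessary conditions on tangent vectors *)

Section Necessity.
Variables (R : realType) (n : nat).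
Implicit Types (p : mpoly n R) (S : set 'cV[R]_n) (x u v w : 'cV[R]_n).

(** The zeroth and first order terms of the expansion vanish, so after division
    by t_k^2/2 the sign condition reads
    Dp(x)v_k + D2p(x)[u,u] + 2 t_k f(t_k, v_k) <= 0, with f bounded along the
    sequence since v_k is. *)
Lemma tangent2_le p S x u w :
  (forall y, S y -> peval p y <= 0) -> peval p x = 0 -> dirder p x u = 0 ->
  tangent2_set S x u w -> dirder p x w + hessq p x u <= 0.
Proof.
move=> Sp px pu [t [v [[t_gt0 t0] vw Sv]]].
have [f tf pf] := has_taylor_poly x u p.
have [L L0 fL] := tf (`|w| + 1).
have [K K0 pK] := dirder_bounded p x.
have KL0 : 0 < K + 2 * L + 1 by rewrite ltr_wpDl // addr_ge0 // mulr_ge0.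
apply/ler_addgt0Pr => e e0; rewrite add0r.
(* With t_k and |w - v_k| below d, the error made by dropping the remainder and
   replacing v_k by w is at most (K + 2 L) d. *)
pose d := Num.min 1 (e / (K + 2 * L + 1)).
have d0 : 0 < d by rewrite lt_min ltr01 divr_gt0.
near \oo => k.
have tk : t k < d.
  have : `|0 - t k| < d by near: k; exact: cvgr_dist_lt t0 _ d0.
  by rewrite sub0r normrN gtr0_norm.
have vk : `|w - v k| < d by near: k; exact: cvgr_dist_lt vw _ d0.
have [tk1 vk1] : t k <= 1 /\ `|w - v k| <= 1.
  by move: tk vk; rewrite !lt_min => /andP[/ltW + _] /andP[/ltW + _].
have vkM : `|v k| <= `|w| + 1.
  have -> : v k = w - (w - v k) by rewrite subKr.
  by rewrite (le_trans (ler_normB _ _)) // lerD2l.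
have tk0 := t_gt0 k.
have tk1' : `|t k| <= 1 by rewrite gtr0_norm.
have [ft _] := fL _ _ _ tk1' vkM vkM.
have dL : dirder p x (v k) + hessq p x u + 2 * t k * f (t k) (v k) <= 0.
  have := Sp _ (Sv k); rewrite -[_ + _]/(parabola x u (v k) (t k)) pf px pu.
  have -> : 0 + t k * 0 + 2^-1 * t k ^+ 2 * (dirder p x (v k) + hessq p x u)
      + t k ^+ 3 * f (t k) (v k) = (2^-1 * t k ^+ 2) *
      (dirder p x (v k) + hessq p x u + 2 * t k * f (t k) (v k)) by field.
  by rewrite pmulr_rle0 // mulr_gt0 ?exprn_gt0 ?invr_gt0.
have dK : dirder p x w - dirder p x (v k) <= K * d.
  rewrite -dirderB (le_trans (ler_norm _)) // (le_trans (pK _)) //.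
  by rewrite ler_wpM2l // ltW.
have fd : - (t k * f (t k) (v k)) <= d * L.
  apply: (@le_trans _ _ (t k * L)); last by rewrite ler_wpM2r // ltW.
  by rewrite -mulrN ler_pM2l // (le_trans _ ft) // -normrN ler_norm.
have dE : (K + 2 * L + 1) * d <= e.
  by rewrite mulrC -ler_pdivlMr // ge_min lexx orbT.
by nra.
Unshelve. all: by end_near. Qed.

(** A first-order approach x + t v is a second-order one with base direction 0
    and time sqrt (2t), so the first-order necessary conditions below follow from
    the second-order ones. *)
Lemma tangent_cone_sub S x : tangent_cone S x `<=` tangent2_set S x 0.
Proof.
move=> u [t [v [[t_gt0 t0] vu Sv]]].
exists (fun k => Num.sqrt (2 * t k)), v; split=> // [|k].
  split=> [k|]; first by rewrite sqrtr_gt0 mulr_gt0.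
  have -> : 0 = Num.sqrt (2 * 0) :> R by rewrite mulr0 sqrtr0.
  by apply: continuous_cvg; [exact: sqrt_continuous | exact: cvgMr].
rewrite scaler0 addr0 sqr_sqrtr ?mulr_ge0 ?(ltW (t_gt0 k)) //.
by rewrite mulrA mulVf ?pnatr_eq0 // mul1r; exact: Sv.
Qed.

Lemma tangent_cone_le p S x u :
  (forall y, S y -> peval p y <= 0) -> peval p x = 0 ->
  tangent_cone S x u -> dirder p x u <= 0.
Proof.
move=> Sp px /tangent_cone_sub uT.
have := tangent2_le Sp px _ uT; rewrite /hessq !mulmx0 mxE addr0; apply.
by rewrite /dirder mulmx0 mxE.
Qed.

Lemma tangent2_eq0 p S x u w :
  (forall y, S y -> peval p y = 0) -> peval p x = 0 -> dirder p x u = 0 ->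
  tangent2_set S x u w -> dirder p x w + hessq p x u = 0.
Proof.
move=> Sp px pu wT; apply/eqP; rewrite eq_le.
rewrite (tangent2_le _ px pu wT) => [|y /Sp-> //].
rewrite -oppr_le0 opprD -dirderN -hessqN.
apply: (@tangent2_le _ S) wT => [y /Sp py||].
- by rewrite pevalN py oppr0.
- by rewrite pevalN px oppr0.
- by rewrite dirderN pu oppr0.
Qed.

Lemma tangent_cone_eq0 p S x u :
  (forall y, S y -> peval p y = 0) -> peval p x = 0 ->
  tangent_cone S x u -> dirder p x u = 0.
Proof.
move=> Sp px /tangent_cone_sub uT.
have := tangent2_eq0 Sp px _ uT; rewrite /hessq !mulmx0 mxE addr0; apply.
by rewrite /dirder mulmx0 mxE.
Qed.

End Necessity.

(** * Arcs with a prescribed second-order behaviour *)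

Section Arc.
Variables (R : realType) (n : nat).
Implicit Types (p : mpoly n R) (x u v w : 'cV[R]_n).

(** A Lyusternik-type statement: where the Jacobian has full row rank, the
    parabola of second-order coefficient w can be corrected by O(t) in that
    coefficient so that F has no error beyond order 2.  The correction B z is the
    fixed point of z |-> - 2 t f(t, w + B z), B being a right inverse of the
    Jacobian; this map is O(t) in norm and in Lipschitz constant. *)
Lemma second_order_arc m (F : 'I_m -> mpoly n R) x u w :
  (forall i, peval (F i) x = 0) -> jac F x *m u = 0 -> row_free (jac F x) ->
  exists C, \forall t \near 0^'+, exists2 v, `|v - w| <= C * t &
    forall i, peval (F i) (parabola x u v t)
      = 2^-1 * t ^+ 2 * (dirder (F i) x w + hessq (F i) x u).
Proof.
move=> Fx Fu /mulmxVp; set A := jac F x; set B := pinvmx A => AB.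
have Frow i v : dirder (F i) x v = (A *m v) i 0 by rewrite jac_mulmxE.
have /choice[f /all_and2[tf Ff]] : forall i, exists f,
    tame f /\ taylor_with x u (F i) f.
  by move=> i; have [f tf Ff] := has_taylor_poly x u (F i); exists f.
have [K K0 BK] := mulmx_bounded B.
have /choice[L0 fL0] : forall i, exists L, 0 <= L /\ forall t v v',
    `|t| <= 1 -> `|v| <= `|w| + K -> `|v'| <= `|w| + K ->
    `|f i t v| <= L /\ `|f i t v - f i t v'| <= L * `|v - v'|.
  by move=> i; have [L L_ge0 fL] := tf i (`|w| + K); exists L.
pose L := \sum_i L0 i.
have L_ge0 : 0 <= L by apply: sumr_ge0 => i _; case: (fL0 i).
have leL i : L0 i <= L.
  by rewrite /L (bigD1 i) //= lerDl sumr_ge0 // => j _; case: (fL0 j).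
exists (2 * L * K); near=> t.
have t0 : 0 < t by near: t; exact: nbhs_right_gt.
(* This bound on t makes Phi below map the unit ball to itself and contract it
   by a factor 1/2. *)
have tD : t <= (1 + 4 * L + 4 * L * K)^-1.
  near: t; apply: nbhs_right_le; rewrite invr_gt0.
  by rewrite !ltr_wpDr // !mulr_ge0.
have D0 : 0 < 1 + 4 * L + 4 * L * K by rewrite !ltr_wpDr // !mulr_ge0.
have tD1 : t * (1 + 4 * L + 4 * L * K) <= 1.
  by rewrite -ler_pdivlMr // mul1r.
have tL0 : 0 <= t * L by rewrite mulr_ge0 // ltW.
have tLK0 : 0 <= t * (L * K) by rewrite !mulr_ge0 // ltW.
have t1 : t <= 1 by nra.
have tL : 2 * t * L <= 1 by nra.
have tLK : 2 * t * L * K <= 2^-1 by nra.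
have t1' : `|t| <= 1 by rewrite gtr0_norm.
have t20 : 0 < 2 * t by rewrite mulr_gt0.
pose Phi (z : 'cV[R]_m) : 'cV[R]_m := \col_i (- (2 * t * f i t (w + B *m z))).
pose U := [set z : 'cV[R]_m | `|z| <= 1].
have UM z : U z -> `|w + B *m z| <= `|w| + K.
  move=> z1; rewrite (le_trans (ler_normD _ _)) // lerD2l.
  by rewrite (le_trans (BK z)) // ler_piMr.
have PhiB z : U z -> `|Phi z| <= 2 * t * L.
  move=> /UM zM; apply: ler_cV_norm => [|i]; first by rewrite !mulr_ge0 // ltW.
  rewrite mxE normrN normrM (gtr0_norm t20) ler_pM2l // (le_trans _ (leL i)) //.
  by have [] := (fL0 i).2 t _ _ t1' zM zM.
have PhiU : {homo Phi : z / U z >-> U z} by move=> z /PhiB/le_trans; apply.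
have contr : is_contraction (mkfun_fun PhiU).
  exists (2^-1)%:nng; split=> /= [|[z z'] [/= Uz Uz']].
    by rewrite invf_lt1 // ltr1n.
  apply: ler_cV_norm => [|i]; first by rewrite mulr_ge0.
  rewrite !mxE -opprD normrN -mulrBr normrM (gtr0_norm t20).
  have [_ /le_trans lipf] := (fL0 i).2 t _ _ t1' (UM z Uz) (UM z' Uz').
  apply: (@le_trans _ _ (2 * t * (L * (K * `|z - z'|)))).
    rewrite ler_pM2l // lipf // ler_pM // ?(fL0 i).1 //.
    by rewrite opprD addrACA subrr add0r -mulmxBr.
  by rewrite !mulrA ler_wpM2r.
have Uclosed : closed U.
  have -> : U = closed_ball 0 1.
    rewrite closed_ballE //; apply/funext => z.
    by rewrite /U /closed_ball_ /= sub0r normrN.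
  exact: closed_ball_closed.
have [|z Uz zE] := banach_fixed_point contr Uclosed.
  by exists 0; rewrite /U /= normr0 ler01.
exists (w + B *m z).
  rewrite addrC addKr (le_trans (BK z)) //.
  rewrite [leRHS](_ : _ = K * (2 * t * L)); last by ring.
  by rewrite ler_wpM2l // zE PhiB.
move=> i; rewrite Ff Fx Frow Fu mxE !Frow mulmxDr mulmxA AB mul1mx [(_ + z) _ _]mxE.
have -> : z i 0 = - (2 * t * f i t (w + B *m z)) by rewrite {1}zE mxE.
by field.
Unshelve. all: by end_near. Qed.

(** The constant or linear term of the expansion is negative and dominates the
    rest for small t, uniformly for v in a ball. *)
Lemma parabola_le0 p x u M :
  peval p x < 0 \/ peval p x = 0 /\ dirder p x u < 0 ->
  \forall t \near 0^'+, forall v, `|v| <= M -> peval p (parabola x u v t) <= 0.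
Proof.
have [f tf pf] := has_taylor_poly x u p.
have [L L0 fL] := tf M.
have [K K0 pK] := dirder_bounded p x.
pose Q := K * `|M| + `|hessq p x u| + L.
have Q0 : 0 <= Q by rewrite !addr_ge0 // mulr_ge0.
have bound t v : 0 < t -> t <= 1 -> `|v| <= M ->
    peval p (parabola x u v t) <= peval p x + t * (dirder p x u + t * Q).
  move=> t0 t1 vM; have t1' : `|t| <= 1 by rewrite gtr0_norm.
  have [fb _] := fL t v v t1' vM vM; have := le_trans (ler_norm _) fb.
  have : dirder p x v <= K * `|M|.
    rewrite (le_trans (ler_norm _)) // (le_trans (pK v)) // ler_wpM2l //.
    exact: le_trans vM (ler_norm M).
  have := ler_norm (hessq p x u).
  move=> hH hD hf; rewrite pf [in leRHS]mulrDr [leRHS]addrA -[leLHS]addrA lerD2l /Q.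
  have tfL : t * f t v <= L.
    by rewrite (le_trans (ler_norm _)) // normrM -[L]mul1r ler_pM.
  have -> : 2^-1 * t ^+ 2 * (dirder p x v + hessq p x u) + t ^+ 3 * f t v
     = t ^+ 2 * (2^-1 * (dirder p x v + hessq p x u) + t * f t v) by ring.
  rewrite mulrA -expr2 ler_pM2l ?exprn_gt0 //.
  have KM0 : 0 <= K * `|M| by rewrite mulr_ge0.
  by have h0 := normr_ge0 (hessq p x u); lra.
have Q1 : 0 < Q + 1 by rewrite ltr_wpDl.
move=> [pn|[p0 un]].
  have bQ : 0 < `|dirder p x u| + Q + 1 by rewrite ltr_wpDl // addr_ge0.
  near=> t => v vM.
  have t0 : 0 < t by near: t; exact: nbhs_right_gt.
  have t1 : t <= 1 by near: t; exact: nbhs_right_le.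
  have tp : t * (`|dirder p x u| + Q + 1) <= - peval p x.
    rewrite -ler_pdivlMr //; near: t; apply: nbhs_right_le.
    by rewrite divr_gt0 // oppr_gt0.
  apply: le_trans (bound t v t0 t1 vM) _.
  have : t * (dirder p x u + t * Q) <= t * (`|dirder p x u| + Q + 1).
    rewrite ler_pM2l // -addrA lerD ?ler_norm // (@le_trans _ _ (1 * Q)) //.
      by rewrite ler_wpM2r.
    by rewrite mul1r lerDl.
  lra.
near=> t => v vM.
have t0 : 0 < t by near: t; exact: nbhs_right_gt.
have t1 : t <= 1 by near: t; exact: nbhs_right_le.
have tb : t * (Q + 1) <= - dirder p x u.
  rewrite -ler_pdivlMr //; near: t; apply: nbhs_right_le.
  by rewrite divr_gt0 // oppr_gt0.
apply: le_trans (bound t v t0 t1 vM) _.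
by rewrite p0 add0r pmulr_rle0 //; lra.
Unshelve. all: by end_near. Qed.

End Arc.

(** * The second-order tangent set of the constraint system *)

Section ConstraintFamily.
Variables (R : realType) (n r s : nat).
Variables (g : 'I_r -> mpoly n R) (h : 'I_s -> mpoly n R).
Implicit Types (x u v w : 'cV[R]_n) (J : {set 'I_s}).

(** The constraints whose gradients are the rows of [grad_family], in the same
    order. *)
Definition constr_family J (k : 'I_(r + #|J|)) : mpoly n R :=
  match fintype.split k with inl i => g i | inr j => h (enum_val j) end.
Arguments constr_family : clear implicits.

Lemma constr_familyl J i : constr_family J (lshift #|J| i) = g i.
Proof. by rewrite /constr_family (unsplitK (inl i)). Qed.

Lemma constr_familyr J j : constr_family J (rshift r j) = h (enum_val j) :> mpoly n R.
Proof. by rewrite /constr_family (unsplitK (inr j : 'I_r + 'I_#|J|)). Qed.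

Lemma jac_family J x : jac (constr_family J) x = grad_family g h J x.
Proof.
by apply/matrixP => k l; rewrite !mxE /constr_family; case: fintype.split => i; rewrite !mxE.
Qed.

Lemma tangent2_linearized x u :
  feasible g h x -> tangent_cone (feasible g h) x u ->
  tangent2_set (feasible g h) x u `<=` linearized2_set g h x u.
Proof.
move=> [gx hx] uT w wT; split; last first.
  move=> j; rewrite !inE => /andP[/eqP hj /eqP hju].
  by apply: tangent2_le hj hju wT => y [_ /(_ j)].
have gS i y : feasible g h y -> peval (g i) y = 0 by case.
have gu i := tangent_cone_eq0 (gS i) (gx i) uT.
apply/colP => i; rewrite mxE jac_mulmxE !mxE.
exact: tangent2_eq0 (gS i) (gx i) (gu i) wT.
Qed.

(** The arc of [second_order_arc] for the family of all g_i and of the h_j, j in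
    I_0, is feasible: there h_j equals t^2/2 times its nonpositive linearization,
    and the remaining inequalities are slack along u. *)
Lemma linearized_arc x u w : feasible g h x -> tangent_cone (feasible g h) x u ->
  row_free (grad_family g h (active0 h x u) x) -> linearized2_set g h x u w ->
  exists C, \forall t \near 0^'+, exists2 v, `|v - w| <= C * t &
    feasible g h (parabola x u v t).
Proof.
move=> [gx hx] uT; set J := active0 h x u; rewrite -jac_family => Jfree [gw hw].
have J0 j : j \in J -> peval (h j) x = 0 /\ dirder (h j) x u = 0.
  by rewrite !inE => /andP[/eqP-> /eqP->].
have gu i : dirder (g i) x u = 0.
  by apply: tangent_cone_eq0 (gx i) uT => y [].
have Fx k : peval (constr_family J k) x = 0.
  rewrite /constr_family; case: fintype.split => [i|j]; first exact: gx.
  by have [] := J0 _ (enum_valP j).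
have Fu : jac (constr_family J) x *m u = 0.
  apply/colP => k; rewrite jac_mulmxE mxE /constr_family; case: fintype.split => [i|j] //.
  by have [] := J0 _ (enum_valP j).
have [C arcC] := second_order_arc w Fx Fu Jfree.
have slack j : j \notin J ->
    peval (h j) x < 0 \/ peval (h j) x = 0 /\ dirder (h j) x u < 0.
  rewrite !inE; case: (ltgtP (peval (h j) x) 0) (hx j) => //= [|hj _ hju].
    by left.
  right; split=> //; rewrite lt_neqAle hju.
  by apply: tangent_cone_le hj uT => y [_ /(_ j)].
(* For t <= 1 the bound |v - w| <= C t keeps v in this fixed ball. *)
have near_slack : \forall t \near 0^'+, forall j, j \notin J ->
    forall v, `|v| <= `|w| + `|C| -> peval (h j) (parabola x u v t) <= 0.
  apply: filter_forall => j; have [jJ|/slack/parabola_le0 jn] := boolP (j \in J).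
    exact: nearW.
  by apply: filterS (jn (`|w| + `|C|)) => t jt _; exact: jt.
exists C; near=> t.
have t0 : 0 < t by near: t; exact: nbhs_right_gt.
have t1 : t <= 1 by near: t; exact: nbhs_right_le.
have [v vw Fv] : exists2 v, `|v - w| <= C * t &
    forall k, peval (constr_family J k) (parabola x u v t)
      = 2^-1 * t ^+ 2 * (dirder (constr_family J k) x w + hessq (constr_family J k) x u).
  by near: t.
exists v => //; split=> [i|j].
  rewrite -(constr_familyl J) Fv constr_familyl.
  move/colP/(_ i): gw; rewrite mxE jac_mulmxE !mxE => ->.
  by rewrite mulr0.
have [jJ|jJ] := boolP (j \in J).
  have hE : h j = constr_family J (rshift r (enum_rank_in jJ j)).
    by rewrite constr_familyr enum_rankK_in.
  rewrite hE Fv -hE pmulr_rle0 ?hw // mulr_gt0 ?invr_gt0 // exprn_gt0 //.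
have vC : `|v| <= `|w| + `|C|.
  have -> : v = w + (v - w) by rewrite addrC subrK.
  rewrite (le_trans (ler_normD _ _)) // lerD2l (le_trans vw) //.
  rewrite (le_trans (ler_norm _)) // normrM (gtr0_norm t0) ler_piMr //.
by move: j jJ v vC {vw Fv}; near: t.
Unshelve. all: by end_near. Qed.

Lemma tangent2_of_arc (S : set 'cV[R]_n) x u w C :
  (\forall t \near 0^'+, exists2 v, `|v - w| <= C * t & S (parabola x u v t)) ->
  tangent2_set S x u w.
Proof.
move=> /nbhs_ballP[d /= d0 arcd].
pose t k : R := d / 2 * harmonic k.
have tk0 k : 0 < t k by rewrite mulr_gt0 ?divr_gt0 ?harmonic_gt0.
have t0 : t k @[k --> \oo] --> (0 : R).
  by rewrite -(mulr0 (d / 2)); apply: cvgMr; exact: cvg_harmonic.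
have /choice[v vP] : forall k, exists v, `|v - w| <= C * t k /\
    S (parabola x u v (t k)).
  move=> k; have [||v vw Sv] := arcd (t k); last by exists v.
    rewrite /ball /= sub0r normrN gtr0_norm // /t.
    have d2 : d / 2 < d by rewrite ltr_pdivrMr // ltr_pMr // ltr1n.
    have h1 : harmonic k <= 1 :> R by rewrite /= invf_le1 ?ler1n // ltr0n.
    by rewrite (le_lt_trans _ d2) // ler_piMr // divr_ge0 // ltW.
  exact: tk0.
exists t, v; split=> // [|k]; last by have [] := vP k.
have Ct0 : C * t k @[k --> \oo] --> (0 : R).
  by rewrite -(mulr0 C); exact: cvgMr.
apply/cvgrPdist_le => e e0; near=> k; rewrite distrC (le_trans (vP k).1) //.
rewrite (le_trans (ler_norm _)) // -normrN -sub0r.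
by near: k; exact: cvgr_dist_le Ct0 _ e0.
Unshelve. all: by end_near. Qed.

End ConstraintFamily.

Theorem theorem3p6 (R : realType) (n r s : nat)
    (g : 'I_r -> mpoly n R) (h : 'I_s -> mpoly n R)
    (xbar u : 'cV[R]_n)
    (xbarS : feasible g h xbar)
    (uT : tangent_cone (feasible g h) xbar u)
    (lin_indep : row_free (grad_family g h (active0 h xbar u) xbar))
    (const_rank : \forall x \near xbar, stratum g h (active0 h xbar u) x ->
       \rank (grad_family g h (active0 h xbar u) x)
         = \rank (grad_family g h (active0 h xbar u) xbar)) :
  tangent2_set (feasible g h) xbar u = linearized2_set g h xbar u.
Proof.
apply/seteqP; split; first exact: tangent2_linearized.
by move=> w /(linearized_arc xbarS uT lin_indep)[C /tangent2_of_arc].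
Qed.
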